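(* Let $A>0$, $\beta\in\mathbb{R}$, $\rho_\pm>0$, $u_\pm\ge 0$ be constants with $$0\le u_+<u_--\frac{A}{\rho_-}\quad\text{and}\quad \rho_+\neq\rho_- .$$ Then the delta shock wave solution (in the sense defined in the context) of the Riemann problem $$\rho_t+(\rho u)_x=0,\qquad \Big(\rho\big(u-\tfrac{A}{\rho}\big)\Big)_t+\Big(\rho u\big(u-\tfrac{A}{\rho}\big)\Big)_x=\beta\rho,$$ $$(\rho,u)(x,0)=(\rho_-,u_-)\ (x<0),\qquad (\rho,u)(x,0)=(\rho_+,u_+)\ (x>0),$$ is given by $$(\rho,u)(x,t)=\begin{cases}(\rho_-,\,u_-+\beta t), & x<x(t),\\ (w(t)\,\delta(x-x(t)),\,u_\delta(t)), & x=x(t),\\ (\rho_+,\,u_++\beta t), & x>x(t),\end{cases}$$ where $$\sigma(t)=u_\delta(t)=v_\delta+\beta t,\qquad x(t)=v_\delta t+\tfrac12\beta t^2,\qquad w(t)=w_0t,$$ $$w_0=\sqrt{\rho_+\rho_-(u_+-u_-)\Big((u_+-u_-)-\Big(\frac{A}{\rho_+}-\frac{A}{\rho_-}\Big)\Big)},\qquad v_\delta=\frac{\rho_+u_+-\rho_-u_-+w_0}{\rho_+-\rho_-}.$$ In particular these quantities satisfy, for $t>0$, the generalized Rankine–Hugoniot conditions $$\frac{dx(t)}{dt}=\sigma(t)=u_\delta(t),\qquad \frac{dw(t)}{dt}=\sigma(t)[\rho]-[\rho u],\qquad \frac{d(w(t)u_\delta(t))}{dt}=\sigma(t)\Big[\rho\big(u-\tfrac{A}{\rho}\big)\Big]-\Big[\rho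 u\big(u-\tfrac{A}{\rho}\big)\Big]+\beta w(t).$$
   Context: Jumps: $[q]$ denotes the value of $q$ at the right state $(\rho_+,u_++\beta t)$ minus its value at the left state $(\rho_-,u_-+\beta t)$; e.g. $[\rho u]=\rho_+(u_++\beta t)-\rho_-(u_-+\beta t)$. Delta shock wave solution. Consider a pair of the displayed form (left state, delta on a curve $x=x(t)$ with $x(0)=0$ and weight $w(t)$ with $w(0)=0$, right state), with $u_\delta(t)$ the value assigned to $u$ on the curve and $u_\delta(t)-\beta t$ constant. Let $\hat\rho$ be the regular part of $\rho$: $\hat\rho=\rho_-$ for $x<x(t)$ and $\hat\rho=\rho_+$ for $x>x(t)$. For a test function $\psi$ set $$\langle\rho,\psi\rangle=\iint\hat\rho\,\psi\,dx\,dt+\int_0^\infty w(t)\psi(x(t),t)\,dt,\qquad \langle\rho u,\psi\rangle=\iint\hat\rho u\,\psi\,dx\,dt+\int_0^\infty w(t)u_\delta(t)\psi(x(t),t)\,dt,$$ $$\Big\langle\rho\big(u-\tfrac A\rho\big),\psi\Big\rangle=\iint\hat\rho\big(u-\tfrac{A}{\hat\rho}\big)\psi\,dx\,dt+\int_0^\infty w(t)u_\delta(t)\psi(x(t),t)\,dt,$$ $$\Big\langle\rho u\big(u-\tfrac A\rho\big),\psi\Big\rangle=\iint\hat\rho u\big(u-\tfrac{A}{\hat\rho}\big)\psi\,dx\,dt+\int_0^\infty w(t)u_\delta(t)^2\psi(x(t),t)\,dt,$$ the double integrals being over $\mathbb{R}\times(0,\infty)$ (the convention is that $1/\rho=0$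 on the delta shock). The pair is a delta shock wave solution if, for all $\psi\in C_0^\infty(\mathbb{R}\times(0,\infty))$, $$\langle\rho,\psi_t\rangle+\langle\rho u,\psi_x\rangle=0,\qquad \Big\langle\rho\big(u-\tfrac A\rho\big),\psi_t\Big\rangle+\Big\langle\rho u\big(u-\tfrac A\rho\big),\psi_x\Big\rangle=-\langle\beta\rho,\psi\rangle,$$ and it is moreover required to satisfy the generalized Rankine–Hugoniot conditions displayed in the claim and, for uniqueness, the over-compressive entropy condition $$u_++\beta t<u_\delta(t)<u_--\frac{A}{\rho_-}+\beta t .$$ *)

(* Defs.v *)
From HB Require Import structures.
From mathcomp Require Import all_boot all_order all_algebra.
From mathcomp Require Import all_classical all_reals all_analysis.

Set Implicit Arguments.
Unset Strict Implicit.
Unset Printing Implicit Defensive.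

Import Order.TTheory GRing.Theory Num.Theory.
Import numFieldNormedType.Exports.

Local Open Scope classical_set_scope.
Local Open Scope ring_scope.

Section TestFunctions.
Context {R : realType}.

(* Points of the plane are pairs z = (x, t): space first, time second. *)

Definition dx (f : R * R -> R) : R * R -> R := fun z => 'D_(1, 0) f z.
Definition dt (f : R * R -> R) : R * R -> R := fun z => 'D_(0, 1) f z.

(* All partial derivatives of order <= n exist and are continuous. *)
Fixpoint class_C (n : nat) (f : R * R -> R) : Prop :=
  continuous f /\
  if n is n'.+1 then
    [/\ forall z, derivable f z (1, 0), forall z, derivable f z (0, 1),
        class_C n' (dx f) & class_C n' (dt f)]
  else True.

Definition fsupport (f : R * R -> R) : set (R * R) :=
  closure [set z | f z != 0].

Definition half_plane : set (R * R) := [set z | 0 < z.2].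

(* Elements of C_0^oo(R x (0, oo)), identified with their extension by 0 to
   the whole plane. *)
Definition test_function (psi : R * R -> R) : Prop :=
  [/\ forall n, class_C n psi, compact (fsupport psi) &
      fsupport psi `<=` half_plane].

End TestFunctions.

(* A pair (rho, u) consisting of two constant-density states separated by a
   delta shock is determined by the curve x = front t, the weight of the Dirac
   mass carried by the curve and the value of u on the curve. Only the values
   at t >= 0 are meaningful. *)
Record delta_shock (R : realType) := DeltaShock {
  front : R -> R;
  weight : R -> R;
  u_delta : R -> R
}.

Section RiemannProblem.
Context {R : realType}.
Context (A beta rho_m u_m rho_p u_p : R).
Implicit Types (S : delta_shock R) (psi : R * R -> R) (t : R).

Let mu := @lebesgue_measure R.

(* The value on the curve itself is irrelevant: the curve is a null set. *)
Definition regular_density S (z : R * R) : R :=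
  if z.1 < front S z.2 then rho_m else rho_p.

Definition velocity S (z : R * R) : R :=
  if z.1 < front S z.2 then u_m + beta * z.2
  else if z.1 == front S z.2 then u_delta S z.2
  else u_p + beta * z.2.

(* The distribution with regular part g and a Dirac mass of density c t on
   the curve, applied to psi. *)
Definition pairing S (g : R * R -> R) (c : R -> R) psi : R :=
  (\int[(mu \x mu)%E]_(z in half_plane) (g z * psi z)) +
  (\int[mu]_(t in `]0, +oo[) (c t * psi (front S t, t))).

Definition pair_rho S : (R * R -> R) -> R :=
  pairing S (regular_density S) (weight S).

Definition pair_rho_u S : (R * R -> R) -> R :=
  pairing S (fun z => regular_density S z * velocity S z)
    (fun t => weight S t * u_delta S t).

(* In the next two, 1 / rho is 0 on the curve. *)
Definition pair_momentum S : (R * R -> R) -> R :=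
  pairing S
    (fun z => regular_density S z * (velocity S z - A / regular_density S z))
    (fun t => weight S t * u_delta S t).

Definition pair_momentum_flux S : (R * R -> R) -> R :=
  pairing S
    (fun z => regular_density S z * velocity S z *
              (velocity S z - A / regular_density S z))
    (fun t => weight S t * u_delta S t ^+ 2).

Definition pair_source S : (R * R -> R) -> R :=
  pairing S (fun z => beta * regular_density S z)
    (fun t => beta * weight S t).

Definition weak_solution S : Prop :=
  forall psi, test_function psi ->
    pair_rho S (dt psi) + pair_rho_u S (dx psi) = 0 /\
    pair_momentum S (dt psi) + pair_momentum_flux S (dx psi) =
      - pair_source S psi.

Definition riemann_initial_data S : Prop :=
  (forall x, x < 0 ->
     regular_density S (x, 0) = rho_m /\ velocity S (x, 0) = u_m) /\
  (forall x, 0 < x ->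
     regular_density S (x, 0) = rho_p /\ velocity S (x, 0) = u_p).

Definition admissible_form S : Prop :=
  [/\ {within `[0, +oo[, continuous (front S)} /\ front S 0 = 0,
      {within `[0, +oo[, continuous (weight S)} /\ weight S 0 = 0 &
      exists v, forall t, 0 <= t -> u_delta S t - beta * t = v].

(* jump q t is [q] at time t, for a function q of the state (rho, u). *)
Definition jump (q : R -> R -> R) t : R :=
  q rho_p (u_p + beta * t) - q rho_m (u_m + beta * t).

Definition speed S : R -> R := derive1 (front S).

Definition generalized_Rankine_Hugoniot S : Prop :=
  forall t, 0 < t ->
    [/\ is_derive t 1 (front S) (speed S t),
        speed S t = u_delta S t,
        is_derive t 1 (weight S)
          (speed S t * jump (fun rho _ => rho) t -
           jump (fun rho u => rho * u) t) &
        is_derive t 1 (fun s => weight S s * u_delta S s)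
          (speed S t * jump (fun rho u => rho * (u - A / rho)) t -
           jump (fun rho u => rho * u * (u - A / rho)) t +
           beta * weight S t)].

Definition over_compressive S : Prop :=
  forall t, 0 < t ->
    u_p + beta * t < u_delta S t /\
    u_delta S t < u_m - A / rho_m + beta * t.

Definition delta_shock_solution S : Prop :=
  [/\ admissible_form S, riemann_initial_data S, weak_solution S &
      generalized_Rankine_Hugoniot S].

End RiemannProblem.

(* Main.v *)
Require Import Defs.
From HB Require Import structures.
From mathcomp Require Import all_boot all_order all_algebra.
From mathcomp Require Import all_classical all_reals all_analysis.
From mathcomp Require Import measurable_realfun ring lra.

Set Implicit Arguments.
Unset Strict Implicit.
Unset Printing Implicit Defensive.

Import Order.TTheory GRing.Theory Num.Theory.
Import numFieldNormedType.Exports.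

Local Open Scope classical_set_scope.
Local Open Scope ring_scope.

(** Both states and the delta shock accelerate at the same rate [beta], so that
    only constants remain in the jump conditions.  A delta shock
    with [u_delta = v + beta t] starting at the origin satisfies the generalized
    Rankine-Hugoniot conditions iff its weight is [w t] with
      [w = v [rho] - [rho u]],  [w v = v [rho u] - [rho u^2] + A [u]],
    jumps being taken at time 0.  Eliminating [v] leaves [w ^+ 2 = w0 ^+ 2]
    ([strength_sq_jump]).  Entropy forces
    [w = rho_p (v - u_p) + rho_m (u_m - v) > 0], hence [w = w0], and then the
    first equation gives [v] because [rho_p != rho_m]: this is uniqueness
    ([RH_constants], [jump_unique]).  Conversely [v_delta] lies between the two
    entropy bounds because each difference, multiplied by an explicit positive
    factor, is an explicit positive quantity ([speed_gt], [speed_lt]).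

    The weak formulation follows from the jump conditions by the divergence
    theorem on each side of the curve [x = X t].  For a density [a] and a flux
    written relative to the front as [a X' + b],
      [a psi_t + (a X' + b) psi_x
         = (d_t + X' d_x) (a psi) - a' psi + d_x (b psi)].
    The first term integrates to 0 over either side, because the shear
    [x = y + X t] turns it into a pure time derivative of a compactly supported
    function ([region_integral_transport]); the last one leaves the trace
    [+- b psi] on the curve ([region_integral_left], [region_integral_right]).
    A Dirac mass of density [m] moving with the front contributes [- m' psi]
    ([curve_balance]).  What remains on the curve, [b_- - b_+ - m'], is the
    Rankine-Hugoniot deficit ([weak_balance]): 0 for mass and, for momentum,
    the opposite of the source carried by the Dirac mass.

    The analytic preliminaries are: continuous functions of the plane are
    measurable for the product sigma-algebra, the chain rule along a curve from
    continuous partial derivatives, and invariance of integrals under the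
    shear. *)

(** * Functions on the plane *)

Section Plane.
Context {R : realType}.
Implicit Types (f fx ft : R * R -> R) (x t : R).

(** The product sigma-algebra is generated by rectangles, and an open set of the
    plane is the countable union of the rational rectangles that it contains. *)
Lemma open_measurable_plane (U : set (R * R)) : open U -> measurable U.
Proof.
move=> oU.
pose box (a b c d : rat) : set (R * R) :=
  `]ratr a, ratr b[%classic `*` `]ratr c, ratr d[%classic.
rewrite (_ : U = \bigcup_a \bigcup_b \bigcup_c \bigcup_d
    (if `[< box a b c d `<=` U >] then box a b c d else set0)).
  do 4 (apply: bigcupT_measurable_rat => ?).
  by case: ifP => _ //; exact: measurableX.
apply/seteqP; split => [[x t] Uxt|z]; last first.
  by move=> [a _ [b _ [c _ [d _]]]]; case: asboolP => // + bz; exact.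
have /nbhs_ballP[e /= e0 eU] : nbhs (x, t) U by exact: open_nbhs_nbhs.
have [a xa] : exists a : rat, ratr a \in `]x - e, x[%R by apply: rat_in_itvoo; lra.
have [b xb] : exists b : rat, ratr b \in `]x, x + e[%R by apply: rat_in_itvoo; lra.
have [c tc] : exists c : rat, ratr c \in `]t - e, t[%R by apply: rat_in_itvoo; lra.
have [d td] : exists d : rat, ratr d \in `]t, t + e[%R by apply: rat_in_itvoo; lra.
rewrite !in_itv/= in xa xb tc td.
exists a => //; exists b => //; exists c => //; exists d => //.
case: asboolP => [_|]; first by split; rewrite /= in_itv/=; lra.
move=> nbox; exfalso; apply: nbox => -[y s] [/=]; rewrite !in_itv/= => yab scd.
apply: eU; split; rewrite /= /ball /= ltr_norml; lra.
Qed.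

Lemma continuous_measurable_plane f : continuous f -> measurable_fun setT f.
Proof.
move=> /continuousP cf; apply: (measurability _ (RGenOInfty.measurableE R)) => //.
move=> /= _ [_ [a ->] <-]; rewrite setTI.
by apply: open_measurable_plane; apply: cf; exact: interval_open.
Qed.

(* The partial derivatives are directional derivatives on the product space; the
   two growth rates below identify them with derivatives of one-variable slices. *)
Let growth_slice1 f x t :
  (fun h : R => h^-1 *: ((f \o shift (x, t)) (h *: ((1, 0) : R * R)) - f (x, t))) =
  (fun h => h^-1 *: (((fun y => f (y, t)) \o shift x) (h *: (1 : R)) - f (x, t))).
Proof.
apply/funext => h /=; congr (_ *: (f (_, _) - _)).
by rewrite -[RHS]add0r; congr (_ + _); exact: scaler0.
Qed.

Let growth_slice2 f x t :
  (fun h : R => h^-1 *: ((f \o shift (x, t)) (h *: ((0, 1) : R * R)) - f (x, t))) =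
  (fun h => h^-1 *: (((fun s => f (x, s)) \o shift t) (h *: (1 : R)) - f (x, t))).
Proof.
apply/funext => h /=; congr (_ *: (f (_, _) - _)).
by rewrite -[RHS]add0r; congr (_ + _); exact: scaler0.
Qed.

Lemma is_derive_slice1 f x t :
  derivable f (x, t) (1, 0) -> is_derive x 1 (fun y => f (y, t)) (dx f (x, t)).
Proof.
rewrite /dx /derivable /derive growth_slice1 => df; split; first exact: df.
by [].
Qed.

Lemma is_derive_slice2 f x t :
  derivable f (x, t) (0, 1) -> is_derive t 1 (fun s => f (x, s)) (dt f (x, t)).
Proof.
rewrite /dt /derivable /derive growth_slice2 => df; split; first exact: df.
by [].
Qed.

(** The partial derivatives are explicit arguments so that those of a product
    such as [a(t) psi(x, t)] can be written in closed form. *)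
Definition is_C1 f fx ft := [/\ continuous f, continuous fx, continuous ft,
  forall x t : R, is_derive x 1 (fun y => f (y, t)) (fx (x, t)) &
  forall x t : R, is_derive t 1 (fun s => f (x, s)) (ft (x, t))].

Lemma is_C1_continuous_x f fx ft x t :
  is_C1 f fx ft -> {for x, continuous (fun y => f (y, t))}.
Proof.
by move=> [_ _ _ + _] => /(_ x t) [fd _]; exact/differentiable_continuous/derivable1_diffP.
Qed.

(** Only slices are known to be differentiable, so the increment is split as
    [f (g s, s) - f (g t, s)] plus [f (g t, s) - f (g t, t)].  The mean value
    theorem writes the first part as [fx (xi s, s) (g s - g t)] with [xi s]
    between [g t] and [g s]; continuity of [fx] and Caratheodory's
    characterization of the derivative do the rest. *)
Lemma is_C1_chain f fx ft (g : R -> R) g' t : is_C1 f fx ft ->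
  is_derive t 1 g g' ->
  is_derive t 1 (fun s => f (g s, s)) (fx (g t, t) * g' + ft (g t, t)).
Proof.
move=> C1f dg; have [_ cfx _ dfx dft] := C1f.
have MV s : exists2 xi, `|xi - g t| <= `|g s - g t| &
    f (g s, s) - f (g t, s) = fx (xi, s) * (g s - g t).
  have cf : continuous (fun y => f (y, s)) by move=> y; exact: is_C1_continuous_x C1f.
  have [tgs|sgt] := leP (g t) (g s).
  - have [|xi] := @MVT_segment R (fun y => f (y, s)) (fun y => fx (y, s)) _ _ tgs.
    + exact: continuous_subspaceT.
    + rewrite in_itv/= => /andP[gx xg] ->; exists xi => //.
      by rewrite !ger0_norm; lra.
  - have [|xi] := @MVT_segment R (fun y => f (y, s)) (fun y => fx (y, s)) _ _ (ltW sgt).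
    + exact: continuous_subspaceT.
    + rewrite in_itv/= => /andP[gx xg] e; exists xi; last by lra.
      by rewrite !ler0_norm; lra.
have {MV} /choice[xi xiP] := fun s => (exists2P _ _).1 (MV s).
have cg : {for t, continuous g}.
  exact/differentiable_continuous/derivable1_diffP.
have [q [qE cq qt]] := (is_derive1_caratheodory _ _ _).1 dg.
have [r [rE cr rt]] := (is_derive1_caratheodory _ _ _).1 (dft (g t) t).
have xit : xi t = g t.
  by apply/eqP; rewrite -subr_eq0 -normr_le0 (le_trans (xiP t).1)// subrr normr0.
have cxi : {for t, continuous xi}.
  apply/cvgrPdist_le => e e0; near=> s.
  rewrite xit distrC (le_trans (xiP s).1)// distrC; near: s.
  by move/cvgrPdist_le : cg; exact.
have cfxi : {for t, continuous (fun s => fx (xi s, s))}.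
  apply: (@continuous_comp _ _ _ (fun s => (xi s, s)) fx); last exact: cfx.
  exact: cvg_pair cxi cvg_id.
apply/is_derive1_caratheodory; exists (fun s => fx (xi s, s) * q s + r s); split.
- move=> s; have := rE s; have := (xiP s).2; rewrite qE => /eqP.
  rewrite subr_eq => /eqP -> /eqP; rewrite subr_eq => /eqP ->; ring.
- exact: (cvgD (cvgM cfxi cq) cr).
- by rewrite xit qt rt.
Unshelve. all: by end_near. Qed.

End Plane.

(** * Integrals over the two sides of a moving curve *)

Section RegionIntegral.
Context {R : realType}.
Notation mu := (@lebesgue_measure R).
Implicit Types (f : R * R -> R) (D : set R) (X : R -> R).

Lemma segment_measure_lty (a b : R) : (mu `[a, b]%classic < +oo)%E.
Proof. by rewrite lebesgue_measure_itv/=; case: ifP => _; rewrite ?ltry// -EFinB ltry. Qed.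

Lemma integrable_bounded_support d (T : measurableType d)
    (nu : {measure set T -> \bar R}) (B : set T) (g : T -> R) (K : R) :
  measurable B -> (nu B < +oo)%E -> measurable_fun setT g ->
  (forall z, `|g z| <= K) -> (forall z, ~ B z -> g z = 0) ->
  nu.-integrable setT (EFin \o g).
Proof.
move=> mB nuB mg gK g0.
rewrite (_ : EFin \o g = (EFin \o g) \_ B); last first.
  apply/funext => z; rewrite patchE; case: ifPn => // /negP zB /=.
  by rewrite g0// => Bz; apply: zB; rewrite inE.
apply: (iffLR (integrable_mkcond _ mB)); apply: measurable_bounded_integrable => //.
  exact: measurable_funTS.
by exists K; split; rewrite ?num_real// => y Ky z _; exact: le_trans (gK z) (ltW Ky).
Qed.

Definition supported_in (M : R) f := forall x t, f (x, t) != 0 -> `|x| <= M /\ `|t| <= M.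

Definition cont_compact f := continuous f /\ exists M, supported_in M f.

Lemma cc_bounded f : cont_compact f -> exists K, forall z, `|f z| <= K.
Proof.
move=> [cf [M fM]].
have /compact_bounded[K [_ fK]] : compact (f @` (`[- M, M] `*` `[- M, M])).
  apply: continuous_compact; first exact: continuous_subspaceT.
  by apply: compact_setX; exact: segment_compact.
exists (Num.max 0 (K + 1)) => -[x t]; rewrite le_max.
have [->|/fM[xM tM]] := eqVneq (f (x, t)) 0; first by rewrite normr0 lexx.
apply/orP; right; apply: (fK (K + 1)); first lra.
by exists (x, t) => //; split; rewrite /= in_itv/= -ler_norml.
Qed.

(** [f] restricted to the region whose section at time [t] is [X t + D]: the
    left side, the curve and the right side when [D] is the negative half-line,
    the origin and the positive half-line. *)
Definition cut D X f := fun z => \1_D (z.1 - X z.2) * f z.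

Lemma measurable_cut D X f : measurable D -> continuous X -> continuous f ->
  measurable_fun setT (cut D X f).
Proof.
move=> mD cX cf.
have m1 : measurable_fun setT (\1_D : R -> R) by exact: measurable_indic.
have m2 : measurable_fun setT (fun z : R * R => z.1 - X z.2).
  apply: continuous_measurable_plane => z; apply: cvgB; first exact: cvg_fst.
  by apply: (@continuous_comp _ _ _ snd X); [exact: cvg_snd|exact: cX].
apply: measurable_funM; last exact: continuous_measurable_plane.
exact: (measurableT_comp m1 m2).
Qed.

Lemma norm_cut_le D X f z : `|cut D X f z| <= `|f z|.
Proof.
by rewrite /cut indicE normrM; case: (_ \in D); rewrite ?normr1 ?mul1r// normr0 mul0r.
Qed.

Lemma integrable_cut D X f : measurable D -> continuous X -> cont_compact f ->
  (mu \x mu)%E.-integrable setT (EFin \o cut D X f).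
Proof.
move=> mD cX /[dup] f0 [cf [M fM]]; have [K fK] := cc_bounded f0.
have := @integrable_bounded_support _ _ (mu \x mu)%E (`[- M, M] `*` `[- M, M]) (cut D X f) K.
apply.
- exact: measurableX.
- have : (mu `[(- M)%R, M] * mu `[(- M)%R, M] < +oo)%E.
    by rewrite lte_mul_pinfty ?ge0_fin_numE ?segment_measure_lty.
  by rewrite -(product_measure1E mu mu).
- exact: measurable_cut.
- by move=> z; rewrite (le_trans (norm_cut_le _ _ _ _)).
- move=> [x t] xtM; rewrite /cut; have [->|/fM[xM tM]] := eqVneq (f (x, t)) 0.
    by rewrite mulr0.
  by exfalso; apply: xtM; split; rewrite /= in_itv/= -ler_norml.
Qed.

Lemma integrable_cut_slice1 D X f t : measurable D -> continuous X -> cont_compact f ->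
  mu.-integrable setT (EFin \o (fun x => cut D X f (x, t))).
Proof.
move=> mD cX /[dup] f0 [cf [M fM]]; have [K fK] := cc_bounded f0.
have := @integrable_bounded_support _ _ mu `[- M, M]%classic (fun x => cut D X f (x, t)) K.
apply => //.
- exact: segment_measure_lty.
- apply: (measurableT_comp (measurable_cut mD cX cf)).
  exact: pair2_measurable.
- by move=> z; rewrite (le_trans (norm_cut_le _ _ _ _)).
- move=> x xM; rewrite /cut; have [->|/fM[+ tM]] := eqVneq (f (x, t)) 0.
    by rewrite mulr0.
  by rewrite ler_norml => ?; exfalso; apply: xM; rewrite /= in_itv.
Qed.

Lemma integrable_cut_slice2 D X f x : measurable D -> continuous X -> cont_compact f ->
  mu.-integrable setT (EFin \o (fun t => cut D X f (x, t))).
Proof.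
move=> mD cX /[dup] f0 [cf [M fM]]; have [K fK] := cc_bounded f0.
have := @integrable_bounded_support _ _ mu `[- M, M]%classic (fun t => cut D X f (x, t)) K.
apply => //.
- exact: segment_measure_lty.
- apply: (measurableT_comp (measurable_cut mD cX cf)).
  exact: pair1_measurable.
- by move=> z; rewrite (le_trans (norm_cut_le _ _ _ _)).
- move=> t tM; rewrite /cut; have [->|/fM[xM]] := eqVneq (f (x, t)) 0.
    by rewrite mulr0.
  by rewrite ler_norml => ?; exfalso; apply: tM; rewrite /= in_itv.
Qed.

Definition region_integral D X f := \int[(mu \x mu)%E]_z cut D X f z.

Lemma region_integralD D X f g : measurable D -> continuous X ->
  cont_compact f -> cont_compact g ->
  region_integral D X (fun z => f z + g z) =
  region_integral D X f + region_integral D X g.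
Proof.
move=> mD cX f0 g0; rewrite /region_integral -RintegralD//; last 2 first.
- exact: integrable_cut.
- exact: integrable_cut.
by apply: eq_Rintegral => z _; rewrite /cut mulrDr.
Qed.

Lemma region_integralZ D X c f : measurable D -> continuous X -> cont_compact f ->
  region_integral D X (fun z => c * f z) = c * region_integral D X f.
Proof.
move=> mD cX f0; rewrite /region_integral -RintegralZl//; last exact: integrable_cut.
by apply: eq_Rintegral => z _; rewrite /cut mulrCA.
Qed.

(** Both orders of integration are needed: space first for the flux through the
    curve, time first, once the curve is straightened, for the transport term. *)
Lemma region_integral_xt D X f : measurable D -> continuous X -> cont_compact f ->
  region_integral D X f = \int[mu]_t \int[mu]_x cut D X f (x, t).
Proof.
move=> mD cX f0; rewrite /region_integral /Rintegral.
rewrite -(integral21_prod_meas1 (integrable_cut mD cX f0)).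
congr fine; apply: eq_integral => t _; rewrite fineK//.
by apply: integrable_fin_num => //; exact: integrable_cut_slice1.
Qed.

Lemma region_integral_tx D X f : measurable D -> continuous X -> cont_compact f ->
  region_integral D X f = \int[mu]_x \int[mu]_t cut D X f (x, t).
Proof.
move=> mD cX f0; rewrite /region_integral /Rintegral.
rewrite -(integral12_prod_meas1 (integrable_cut mD cX f0)).
congr fine; apply: eq_integral => t _; rewrite fineK//.
by apply: integrable_fin_num => //; exact: integrable_cut_slice2.
Qed.

(** Translations preserve the lengths of intervals, which determine the measure. *)
Lemma lebesgue_measure_shift c (A : set R) : measurable A ->
  pushforward mu ((fun x => x + c) : _ -> measurableTypeR R) A = mu A.
Proof.
move=> mA; apply/esym/lebesgue_measure_unique => //=.
  apply: continuous_measurable_fun => x.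
  by apply: cvgD; [exact: cvg_id|exact: cvg_cst].
move=> _ _ [[a b] _ <-].
rewrite /pushforward (_ : _ @^-1` _ = `]a - c, b - c]%classic).
  by rewrite !lebesgue_measure_itv/= !lte_fin ltrD2r -!EFinB; case: ifP => // _; congr EFin; ring.
by apply/seteqP; split => x /=; rewrite !in_itv/=; lra.
Qed.

Lemma Rintegral_shift c (g : R -> R) :
  mu.-integrable setT (EFin \o g) -> mu.-integrable setT (EFin \o (fun x => g (x + c))) ->
  \int[mu]_x g (x + c) = \int[mu]_x g x.
Proof.
move=> ig igc; have mg := measurable_int _ ig; rewrite /Rintegral; congr fine.
have ms : measurable_fun setT ((fun x => x + c) : measurableTypeR R -> measurableTypeR R).
  by apply: continuous_measurable_fun => x; apply: cvgD; [exact: cvg_id|exact: cvg_cst].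
have := @integral_pushforward _ _ _ _ _ _ ms mu setT (EFin \o g) mg igc measurableT.
rewrite /= preimage_setT => <-.
by apply: eq_measure_integral => A mA _; exact: lebesgue_measure_shift.
Qed.

Lemma cc_shear X f : continuous X -> cont_compact f ->
  cont_compact (fun z => f (z.1 + X z.2, z.2)).
Proof.
move=> cX [cf [M fM]]; split.
  move=> z; have cX2 : {for z, continuous (fun z : R * R => X z.2)}.
    by apply: (@continuous_comp _ _ _ snd X); [exact: cvg_snd|exact: cX].
  apply: (@continuous_comp _ _ _ (fun z => (z.1 + X z.2, z.2)) f); last exact: cf.
  exact: (cvg_pair (cvgD cvg_fst cX2) cvg_snd).
have /compact_bounded[K [_ XK]] : compact (X @` `[- M, M]).
  apply: continuous_compact; first exact: continuous_subspaceT.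
  exact: segment_compact.
exists (`|M| + (`|K| + 1)) => x t /fM[xM tM].
have XtK : `|X t| <= `|K| + 1.
  apply: (XK (`|K| + 1)); first by have := ler_norm K; lra.
  by exists t => //; rewrite /= in_itv/= -ler_norml.
have := ler_norm M; have := normr_ge0 K.
by move: xM tM XtK; rewrite /= !ler_norml => *; split; lra.
Qed.

(** Slice by slice in time, the shear is a translation. *)
Lemma region_integral_shear D X f : measurable D -> continuous X -> cont_compact f ->
  region_integral D X f =
  region_integral D (cst 0) (fun z => f (z.1 + X z.2, z.2)).
Proof.
move=> mD cX f0; have fX0 := cc_shear cX f0.
have c0 : continuous (@cst R R 0) by move=> ?; exact: cvg_cst.
rewrite (region_integral_xt mD cX f0) (region_integral_xt mD c0 fX0).
apply: eq_Rintegral => t _.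
have E : (fun x => cut D (cst 0) (fun z => f (z.1 + X z.2, z.2)) (x, t)) =
  (fun x => cut D X f (x + X t, t)).
  by apply/funext => x; rewrite /cut /= subr0 addrK.
rewrite -(Rintegral_shift (c := X t) (integrable_cut_slice1 t mD cX f0)).
  by apply: eq_Rintegral => x _; exact/esym/(congr1 (@^~ x) E).
by rewrite -E; exact: integrable_cut_slice1.
Qed.

End RegionIntegral.

(** * The divergence theorem along the curve *)

Section DivergenceTheorem.
Context {R : realType}.
Notation mu := (@lebesgue_measure R).

Lemma Rintegral_derive (F f : R -> R) (a b : R) : a < b -> continuous f ->
  (forall x : R, is_derive x 1 F (f x)) ->
  \int[mu]_(x in `[a, b]) f x = F b - F a.
Proof.
move=> ab cf dF.
have cF : continuous F.
  by move=> x; exact/differentiable_continuous/derivable1_diffP.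
rewrite /Rintegral (@continuous_FTC2 _ f F)//.
- exact: continuous_subspaceT.
- split; first by move=> x _; exact: ex_derive.
  + exact/cvg_at_right_filter/cF.
  + exact/cvg_at_left_filter/cF.
- by move=> x _; rewrite derive1E; exact: derive_val.
Qed.

Section CompactSupport.
Variables (F f : R -> R) (M : R).
Hypotheses (cf : continuous f) (dF : forall x : R, is_derive x 1 F (f x)).
Hypothesis F0 : forall x, M < `|x| -> F x = 0.

(* A derivative vanishes where the function is locally constant, so only the
   support of F has to be controlled. *)
Let f0 x : M < `|x| -> f x = 0.
Proof.
move=> Mx; have := @derive_val _ _ _ _ _ _ _ (dF x) => <-.
rewrite -(derive_cst (0 : R) x 1); apply: near_eq_derive.
near=> y; rewrite F0//; near: y.
have : {for x, continuous (fun y : R => `|y|)} by exact: norm_continuous.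
by move/cvgr_gt; exact.
Unshelve. all: by end_near. Qed.

Let integrable_itv a b : mu.-integrable `[a, b] (EFin \o f).
Proof.
apply: continuous_compact_integrable; first exact: segment_compact.
exact: continuous_subspaceT.
Qed.

Lemma Rintegral_derive_lt a : \int[mu]_x (\1_`]-oo, 0[ (x - a) * f x) = F a.
Proof.
(* a point to the left of both the support and a *)
set b := - (`|M| + `|a| + 1).
have [Ma aa] : M <= `|M| /\ - a <= `|a| by rewrite ler_norm -normrN ler_norm.
have [Mge0 age0] : 0 <= `|M| /\ 0 <= `|a| by rewrite !normr_ge0.
have bM y : y <= b -> M < `|y| by rewrite /b => yb; rewrite ltr_normr; apply/orP; right; lra.
have -> : \int[mu]_x (\1_`]-oo, 0[ (x - a) * f x) = \int[mu]_(x in `[b, a[) f x.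
  rewrite [RHS]Rintegral_mkcond; apply: eq_Rintegral => x _.
  rewrite patchE indicE !mem_setE !in_itv/= subr_lt0.
  have [xa|] := ltP x a; last by rewrite andbF mul0r.
  by rewrite mul1r andbT; case: leP => // /ltW /bM /f0.
rewrite Rintegral_itv_bndo_bndc; last first.
  by apply: integrableS (integrable_itv b a) => //; apply: subset_itvl; rewrite bnd_simp.
have ba : b < a by rewrite /b; lra.
by rewrite (Rintegral_derive ba cf dF) (F0 (bM b (lexx b))) subr0.
Qed.

Lemma Rintegral_derive_gt a : \int[mu]_x (\1_`]0, +oo[ (x - a) * f x) = - F a.
Proof.
(* a point to the right of both the support and a *)
set b := `|M| + `|a| + 1.
have [Ma aa] : M <= `|M| /\ a <= `|a| by rewrite !ler_norm.
have [Mge0 age0] : 0 <= `|M| /\ 0 <= `|a| by rewrite !normr_ge0.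
have bM y : b <= y -> M < `|y| by rewrite /b => yb; rewrite ltr_normr; apply/orP; left; lra.
have -> : \int[mu]_x (\1_`]0, +oo[ (x - a) * f x) = \int[mu]_(x in `]a, b]) f x.
  rewrite [RHS]Rintegral_mkcond; apply: eq_Rintegral => x _.
  rewrite patchE indicE !mem_setE !in_itv/= andbT subr_gt0.
  have [xa|] := ltP a x; last by rewrite mul0r.
  by rewrite mul1r; case: leP => // /ltW /bM /f0.
rewrite Rintegral_itv_obnd_cbnd; last first.
  by apply: integrableS (integrable_itv a b) => //; apply: subset_itvr; rewrite bnd_simp.
have ab : a < b by rewrite /b; lra.
by rewrite (Rintegral_derive ab cf dF) (F0 (bM b (lexx b))) sub0r.
Qed.

Lemma Rintegral_derive_full : \int[mu]_x f x = 0.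
Proof.
set b := `|M| + 1.
have MM := ler_norm M; have Mge0 := normr_ge0 M.
have bM y : b <= `|y| -> M < `|y| by rewrite /b; lra.
have -> : \int[mu]_x f x = \int[mu]_(x in `[- b, b]) f x.
  rewrite [RHS]Rintegral_mkcond; apply: eq_Rintegral => x _.
  rewrite patchE mem_setE in_itv/= -ler_norml.
  by case: leP => // /ltW /bM /f0.
rewrite (@Rintegral_derive F)//; last by rewrite /b; lra.
by rewrite !F0 ?subrr//; apply: bM; rewrite ?normrN ler_norm.
Qed.

End CompactSupport.

Section Region.
Implicit Types (f fx ft : R * R -> R) (X : R -> R) (D : set R).

Lemma supported_in_eq0 M f x t :
  supported_in M f -> M < `|x| \/ M < `|t| -> f (x, t) = 0.
Proof.
move=> fM xt; apply/eqP; apply: contraT => /fM[].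
by case: xt; rewrite ltNge => /negbTE ->.
Qed.

Lemma continuous_slice1 f t : continuous f -> continuous (fun x => f (x, t)).
Proof.
move=> cf x; apply: (@continuous_comp _ _ _ (fun x => (x, t)) f); last exact: cf.
exact: (cvg_pair cvg_id (cvg_cst t)).
Qed.

Lemma continuous_slice2 f x : continuous f -> continuous (fun t => f (x, t)).
Proof.
move=> cf t; apply: (@continuous_comp _ _ _ (fun t => (x, t)) f); last exact: cf.
exact: (cvg_pair (cvg_cst x) cvg_id).
Qed.

Lemma region_integral_left X f fx ft : continuous X -> is_C1 f fx ft ->
  cont_compact f -> cont_compact fx ->
  region_integral `]-oo, 0[ X fx = \int[mu]_t f (X t, t).
Proof.
move=> cX [cf cfx _ dfx _] [_ [M fM]] fx0.
rewrite region_integral_xt//; apply: eq_Rintegral => t _; rewrite /cut /=.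
apply: (@Rintegral_derive_lt (fun x => f (x, t)) (fun x => fx (x, t)) M) => //.
- exact: continuous_slice1.
- by move=> x Mx; apply: (supported_in_eq0 fM); left.
Qed.

Lemma region_integral_right X f fx ft : continuous X -> is_C1 f fx ft ->
  cont_compact f -> cont_compact fx ->
  region_integral `]0, +oo[ X fx = \int[mu]_t - f (X t, t).
Proof.
move=> cX [cf cfx _ dfx _] [_ [M fM]] fx0.
rewrite region_integral_xt//; apply: eq_Rintegral => t _; rewrite /cut /=.
apply: (@Rintegral_derive_gt (fun x => f (x, t)) (fun x => fx (x, t)) M) => //.
- exact: continuous_slice1.
- by move=> x Mx; apply: (supported_in_eq0 fM); left.
Qed.

(** Each time slice of the curve is a point. *)
Lemma region_integral_curve X f : continuous X -> cont_compact f ->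
  region_integral [set 0] X f = 0.
Proof.
move=> cX f0; rewrite region_integral_xt//.
rewrite (@eq_Rintegral _ _ _ _ _ (cst 0)); first by rewrite Rintegral_cst// mul0r.
move=> t _; rewrite -[RHS](Rintegral_set1 (fun x => f (x, t)) (X t)).
rewrite [RHS]Rintegral_mkcond; apply: eq_Rintegral => x _.
rewrite /cut /= patchE indicE !in_set1 subr_eq0.
by case: eqP; rewrite ?mul1r ?mul0r.
Qed.

(** After the shear the integrand is [d/dt (f (y + X t, t))] at fixed [y], and
    the range of [y] does not depend on [t]; integrating in time first gives 0. *)
Lemma region_integral_transport D X X' f fx ft : measurable D ->
  (forall t : R, is_derive t 1 X (X' t)) -> is_C1 f fx ft ->
  cont_compact f -> cont_compact (fun z => fx z * X' z.2 + ft z) ->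
  region_integral D X (fun z => fx z * X' z.2 + ft z) = 0.
Proof.
move=> mD dX C1f [_ [M fM]] g0.
have cX : continuous X.
  by move=> x; exact/differentiable_continuous/derivable1_diffP.
have gX0 := cc_shear cX g0.
have c0 : continuous (@cst R R 0) by move=> ?; exact: cvg_cst.
rewrite region_integral_shear// region_integral_tx//.
rewrite (@eq_Rintegral _ _ _ _ _ (cst 0)); first by rewrite Rintegral_cst// mul0r.
move=> y _; rewrite /cut /=.
have dF (t : R) : is_derive t 1 (fun t => f (y + X t, t))
    (fx (y + X t, t) * X' t + ft (y + X t, t)).
  apply: (is_C1_chain (g := fun t => y + X t) C1f).
  by rewrite -[X' t]add0r; exact: (is_deriveD (is_derive_cst y t 1) (dX t)).
have cF := continuous_slice2 (x := y) gX0.1.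
have FM (t : R) : M < `|t| -> f (y + X t, t) = 0.
  by move=> Mt; apply: (supported_in_eq0 fM); right.
have int0 := Rintegral_derive_full cF dF FM.
rewrite indicE; case: (_ \in D).
  by under eq_Rintegral do rewrite mul1r; exact: int0.
by under eq_Rintegral do rewrite mul0r; rewrite Rintegral_cst// mul0r.
Qed.

End Region.
End DivergenceTheorem.

(** * Balance laws with a Dirac mass on the curve *)

Section BalanceLaw.
Context {R : realType}.
Notation mu := (@lebesgue_measure R).
Implicit Types (f fx ft psi : R * R -> R) (X m a b : R -> R) (D : set R).

Definition C1_fun m m' := (forall t : R, is_derive t 1 m (m' t)) /\ continuous m'.

Lemma C1_fun_continuous m m' : C1_fun m m' -> continuous m.
Proof. by move=> [dm _] t; exact/differentiable_continuous/derivable1_diffP. Qed.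

Definition tmul m f := fun z : R * R => m z.2 * f z.

Lemma continuous_tmul m f : continuous m -> continuous f -> continuous (tmul m f).
Proof.
move=> cm cf z; have cm2 : {for z, continuous (fun z : R * R => m z.2)}.
  by apply: (@continuous_comp _ _ _ snd m); [exact: cvg_snd|exact: cm].
exact: (cvgM cm2 (cf z)).
Qed.

Lemma cc_tmul m f : continuous m -> cont_compact f -> cont_compact (tmul m f).
Proof.
move=> cm [cf [M fM]]; split; first exact: continuous_tmul.
exists M => x t; rewrite /tmul /= => mf; apply: fM; apply: contraNneq mf => ->.
by rewrite mulr0.
Qed.

Lemma ccD f g : cont_compact f -> cont_compact g -> cont_compact (fun z => f z + g z).
Proof.
move=> [cf [M fM]] [cg [N gN]]; split; first by move=> z; exact: (cvgD (cf z) (cg z)).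
exists (Num.max M N) => x t; rewrite !le_max.
have [->|/fM[-> ->]//] := eqVneq (f (x, t)) 0.
by rewrite add0r => /gN[-> ->]; rewrite !orbT.
Qed.

Lemma is_C1_tmul m m' f fx ft : C1_fun m m' -> is_C1 f fx ft ->
  is_C1 (tmul m f) (tmul m fx) (fun z => tmul m' f z + tmul m ft z).
Proof.
move=> C1m [cf cfx cft dfx dft]; have cm := C1_fun_continuous C1m.
have [dm cm'] := C1m; split.
- exact: continuous_tmul.
- exact: continuous_tmul.
- have c1 := continuous_tmul cm' cf; have c2 := continuous_tmul cm cft.
  by move=> z; exact: (cvgD (c1 z) (c2 z)).
- by move=> x t; exact: (is_deriveZ (m t) (dfx x t)).
- move=> x t; apply: (is_derive_eq (is_deriveM (dm t) (dft x t))).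
  by rewrite /tmul /GRing.scale /=; ring.
Qed.

Definition curve_integral X f := \int[mu]_t f (X t, t).

Lemma integrable_curve X f : continuous X -> cont_compact f ->
  mu.-integrable setT (EFin \o (fun t => f (X t, t))).
Proof.
move=> cX /[dup] f0 [cf [M fM]]; have [K fK] := cc_bounded f0.
have := @integrable_bounded_support _ _ _ mu `[- M, M]%classic
  (fun t => f (X t, t)) K.
apply => //.
- exact: segment_measure_lty.
- apply: continuous_measurable_fun => t.
  apply: (@continuous_comp _ _ _ (fun t => (X t, t)) f); last exact: cf.
  exact: (cvg_pair (cX t) cvg_id).
- move=> t tM; have [//|/fM[_]] := eqVneq (f (X t, t)) 0.
  by rewrite ler_norml => ?; exfalso; apply: tM; rewrite /= in_itv.
Qed.

Lemma curve_integralD X f g : continuous X -> cont_compact f -> cont_compact g ->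
  curve_integral X (fun z => f z + g z) = curve_integral X f + curve_integral X g.
Proof.
move=> cX f0 g0; rewrite /curve_integral -RintegralD//; exact: integrable_curve.
Qed.

Lemma curve_integralZ X c f : continuous X -> cont_compact f ->
  curve_integral X (fun z => c * f z) = c * curve_integral X f.
Proof.
move=> cX f0; rewrite /curve_integral -RintegralZl//; exact: integrable_curve.
Qed.

(** The integrand is the derivative of [t |-> f (X t, t)]. *)
Lemma curve_integral_derive X X' f fx ft : C1_fun X X' -> is_C1 f fx ft ->
  cont_compact f -> curve_integral X (fun z => fx z * X' z.2 + ft z) = 0.
Proof.
move=> C1X C1f [_ [M fM]]; have cX := C1_fun_continuous C1X.
have [dX cX'] := C1X; have [_ cfx cft _ _] := C1f.
have dF t := is_C1_chain C1f (dX t).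
apply: (Rintegral_derive_full (F := fun t => f (X t, t)) (M := M)).
- move=> t.
  have cc (h : R * R -> R) : continuous h -> {for t, continuous (fun t => h (X t, t))}.
    move=> ch; apply: (@continuous_comp _ _ _ (fun t => (X t, t)) h); last exact: ch.
    exact: (cvg_pair (cX t) cvg_id).
  exact: (cvgD (cvgM (cc _ cfx) (cX' t)) (cc _ cft)).
- by move=> t Mt; apply: (supported_in_eq0 fM); right.
Qed.

Section Test.
Variables (X X' : R -> R) (psi psix psit : R * R -> R).
Hypotheses (C1X : C1_fun X X') (C1psi : is_C1 psi psix psit).
Hypotheses (psi0 : cont_compact psi) (psix0 : cont_compact psix) (psit0 : cont_compact psit).

Let cX : continuous X. Proof. exact: C1_fun_continuous C1X. Qed.
Let cX' : continuous X'. Proof. by case: C1X. Qed.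

(** [b] is the flux of the density [a] relative to the moving curve. *)
Lemma region_balance D a a' b b' : measurable D -> C1_fun a a' -> C1_fun b b' ->
  region_integral D X (tmul a psit) +
    region_integral D X (tmul (fun t => a t * X' t + b t) psix) =
  - region_integral D X (tmul a' psi) + region_integral D X (tmul b psix).
Proof.
move=> mD C1a C1b; have [ca cb] := (C1_fun_continuous C1a, C1_fun_continuous C1b).
have [_ ca'] := C1a.
have c1 : continuous (fun t => a t * X' t + b t).
  by move=> t; exact: (cvgD (cvgM (ca t) (@cX' t)) (cb t)).
have E0 : cont_compact (fun z => tmul a psix z * X' z.2 + (tmul a' psi z + tmul a psit z)).
  apply: ccD; last by apply: ccD; exact: cc_tmul.
  have -> : (fun z => tmul a psix z * X' z.2) = tmul X' (tmul a psix).
    by apply/funext => z; rewrite /tmul mulrC.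
  by apply: (cc_tmul cX'); exact: cc_tmul.
have at0 := cc_tmul ca psit0; have ca0 := cc_tmul c1 psix0.
have bx0 := cc_tmul cb psix0; have a'0 := cc_tmul ca' psi0.
have : region_integral D X (fun z => tmul a psit z +
      tmul (fun t => a t * X' t + b t) psix z + tmul a' psi z) =
    region_integral D X (fun z => tmul a psix z * X' z.2 +
      (tmul a' psi z + tmul a psit z) + tmul b psix z).
  by congr region_integral; apply/funext => z; rewrite /tmul; ring.
rewrite (region_integralD mD cX (ccD at0 ca0) a'0).
rewrite (region_integralD mD cX at0 ca0) (region_integralD mD cX E0 bx0).
rewrite (region_integral_transport mD C1X.1 (is_C1_tmul C1a C1psi) _ E0); last first.
  exact: cc_tmul.
by rewrite add0r => <-; ring.
Qed.

(** A Dirac mass carried by the curve has no relative flux. *)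
Lemma curve_balance m m' : C1_fun m m' ->
  curve_integral X (tmul m psit) + curve_integral X (tmul (fun t => m t * X' t) psix) =
  - curve_integral X (tmul m' psi).
Proof.
move=> C1m; have cm := C1_fun_continuous C1m; have [_ cm'] := C1m.
have cmX : continuous (fun t => m t * X' t).
  by move=> t; exact: (cvgM (cm t) (@cX' t)).
have mt0 := cc_tmul cm psit0; have mx0 := cc_tmul cmX psix0.
have m'0 := cc_tmul cm' psi0.
apply/eqP; rewrite -addr_eq0 -!curve_integralD//; last exact: ccD.
apply/eqP; rewrite -[RHS](curve_integral_derive C1X (is_C1_tmul C1m C1psi) (cc_tmul cm psi0)).
by congr curve_integral; apply/funext => z; rewrite /tmul; ring.
Qed.

(** The relative fluxes leave traces of opposite signs on the curve, so [r] is
    the defect in the Rankine-Hugoniot condition for the density [a], with Dirac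
    mass [m] and without source on the curve.  The fluxes [qm], [qp], [n] and the
    defect [r] are separate variables to leave their form free in applications. *)
Lemma weak_balance am am' bm bm' ap ap' bp bp' m m' qm qp n r :
  C1_fun am am' -> C1_fun bm bm' -> C1_fun ap ap' -> C1_fun bp bp' -> C1_fun m m' ->
  (forall t, qm t = am t * X' t + bm t) -> (forall t, qp t = ap t * X' t + bp t) ->
  (forall t, n t = m t * X' t) -> (forall t, r t = bm t - bp t - m' t) ->
  (region_integral `]-oo, 0[ X (tmul am psit) +
   region_integral `]0, +oo[ X (tmul ap psit) +
   curve_integral X (tmul m psit)) +
  (region_integral `]-oo, 0[ X (tmul qm psix) +
   region_integral `]0, +oo[ X (tmul qp psix) +
   curve_integral X (tmul n psix)) =
  - (region_integral `]-oo, 0[ X (tmul am' psi) +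
     region_integral `]0, +oo[ X (tmul ap' psi)) +
  curve_integral X (tmul r psi).
Proof.
move=> C1am C1bm C1ap C1bp C1m /funext-> /funext-> /funext-> /funext->.
have mL : measurable (`]-oo, 0[%classic : set R) by [].
have mR : measurable (`]0, +oo[%classic : set R) by [].
have := region_balance mL C1am C1bm; have := region_balance mR C1ap C1bp.
have := curve_balance C1m.
have cbm := C1_fun_continuous C1bm; have cbp := C1_fun_continuous C1bp.
have [_ cm'] := C1m; have bm0 := cc_tmul cbm psi0.
have bp0 := cc_tmul cbp psi0; have m'0 := cc_tmul cm' psi0.
have mx0 := cc_tmul cbm psix0; have px0 := cc_tmul cbp psix0.
rewrite (region_integral_left cX (is_C1_tmul C1bm C1psi))//.
rewrite (region_integral_right cX (is_C1_tmul C1bp C1psi))//.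
have -> : \int[mu]_t - tmul bp psi (X t, t) = - curve_integral X (tmul bp psi).
  rewrite -mulN1r -curve_integralZ//.
  by apply: eq_Rintegral => t _; rewrite mulN1r.
rewrite -/(curve_integral X (tmul bm psi)) => e1 e2 e3.
have -> : tmul (fun t => bm t - bp t - m' t) psi =
    (fun z => tmul bm psi z + -1 * (fun z => tmul bp psi z + tmul m' psi z) z).
  by apply/funext => z; rewrite /tmul; ring.
have s0 := ccD bp0 m'0.
rewrite curve_integralD//; last first.
  by apply: (cc_tmul (m := cst (-1)) _ s0) => ?; exact: cvg_cst.
by rewrite curve_integralZ// curve_integralD//; lra.
Qed.

End Test.
End BalanceLaw.

(** * Test functions and the pairings *)

Section WeakSolution.
Context {R : realType}.
Notation mu := (@lebesgue_measure R).
Implicit Types (S : delta_shock R) (f g psi : R * R -> R).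

Lemma fsupport_eq0 psi z : ~ fsupport psi z -> psi z = 0.
Proof.
by move=> nz; apply: contrapT => /eqP z0; apply: nz; exact: subset_closure.
Qed.

Lemma derive_fsupport_eq0 psi (v : R * R) z : ~ fsupport psi z -> 'D_v psi z = 0.
Proof.
move=> nz; rewrite -(derive_cst (0 : R) z v); apply: near_eq_derive.
have : nbhs z (~` fsupport psi).
  by apply: open_nbhs_nbhs; split => //; exact/closed_openC/closed_closure.
by apply: filterS => y /fsupport_eq0.
Qed.

Lemma cc_fsupport psi f : continuous f -> compact (fsupport psi) ->
  (forall z, ~ fsupport psi z -> f z = 0) -> cont_compact f.
Proof.
move=> cf /compact_bounded[M [_ KM]] f0; split=> //; exists (M + 1) => x t fxt.
have Kxt : fsupport psi (x, t) by apply: contrapT => /f0/eqP; apply/negP.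
have M1 : M < M + 1 by rewrite ltrDl.
have /= := KM (M + 1) M1 (x, t) Kxt.
by rewrite prod_normE/= ge_max => /andP.
Qed.

Definition vanishes_before f := forall z : R * R, z.2 <= 0 -> f z = 0.

Lemma test_functionP psi : test_function psi ->
  [/\ is_C1 psi (dx psi) (dt psi),
      [/\ cont_compact psi, cont_compact (dx psi) & cont_compact (dt psi)] &
      [/\ vanishes_before psi, vanishes_before (dx psi) & vanishes_before (dt psi)]].
Proof.
move=> [/(_ 1%N)/= [cf [dfx dft [cfx _] [cft _]]] K Kpos].
have psi0 z : ~ fsupport psi z -> psi z = 0 by exact: fsupport_eq0.
have dx0 z : ~ fsupport psi z -> dx psi z = 0 by exact: derive_fsupport_eq0.
have dt0 z : ~ fsupport psi z -> dt psi z = 0 by exact: derive_fsupport_eq0.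
have before z : z.2 <= 0 -> ~ fsupport psi z.
  by move=> z0 /Kpos; rewrite /half_plane/= ltNge z0.
split; last by split => z /before; [exact: psi0|exact: dx0|exact: dt0].
- split; [exact: cf|exact: cfx|exact: cft| |] => x t.
  + exact: is_derive_slice1 (dfx (x, t)).
  + exact: is_derive_slice2 (dft (x, t)).
- split; [exact: (cc_fsupport cf K)|exact: (cc_fsupport cfx K)|].
  exact: (cc_fsupport cft K).
Qed.

(** The plane is the union of the two sides and of the curve, and the integral
    over the curve is 0.  As [f] vanishes at nonpositive times, the domains of
    integration can be enlarged to the whole plane and the whole line. *)
Lemma pairingE S g (gm g0 gp c : R -> R) f :
  continuous (front S) -> continuous gm -> continuous g0 -> continuous gp ->
  (forall x t, x < front S t -> g (x, t) = gm t) ->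
  (forall t, g (front S t, t) = g0 t) ->
  (forall x t, front S t < x -> g (x, t) = gp t) ->
  cont_compact f -> vanishes_before f ->
  pairing S g c f =
  region_integral `]-oo, 0[ (front S) (tmul gm f) +
  region_integral `]0, +oo[ (front S) (tmul gp f) +
  curve_integral (front S) (tmul c f).
Proof.
move=> cX cgm cg0 cgp gL gC gR f0 fb; rewrite /pairing; congr (_ + _).
- have gm0 := cc_tmul cgm f0; have g00 := cc_tmul cg0 f0.
  have gp0 := cc_tmul cgp f0.
  have m0 : measurable ([set 0] : set R) by [].
  have iL := @integrable_cut R `]-oo, 0[ (front S) _ (measurable_itv _) cX gm0.
  have iC := @integrable_cut R [set 0] (front S) _ m0 cX g00.
  have iR := @integrable_cut R `]0, +oo[ (front S) _ (measurable_itv _) cX gp0.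
  have iLC := integrableD measurableT iL iC.
  have e := etrans (RintegralD measurableT iLC iR)
    (congr1 (+%R^~ _) (RintegralD measurableT iL iC)).
  have C0 := region_integral_curve cX g00; rewrite /region_integral in C0 *.
  rewrite C0 addr0 in e; rewrite -[RHS]e.
  rewrite Rintegral_mkcond; apply: eq_Rintegral => -[x t] _.
  rewrite /cut /tmul /= !indicE !mem_setE !in_itv/= in_set1 andbT.
  rewrite subr_lt0 subr_gt0 subr_eq0 patchE.
  have -> : (if (x, t) \in half_plane then g (x, t) * f (x, t) else 0) = g (x, t) * f (x, t).
    case: ifPn => //; rewrite notin_setE /half_plane /= => /negP.
    by rewrite -leNgt => t0; rewrite fb// mulr0.
  have [xX|Xx|->] := ltgtP x (front S t).
  + by rewrite gL// !mul0r !addr0 mul1r.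
  + by rewrite gR// !mul0r !add0r mul1r.
  + by rewrite gC !mul0r addr0 add0r mul1r.
- rewrite Rintegral_mkcond; apply: eq_Rintegral => t _.
  rewrite patchE mem_setE in_itv/= andbT /tmul /=.
  by case: ltP => // t0; rewrite fb// mulr0.
Qed.

End WeakSolution.

(** * The parabolic delta shock is a weak solution *)

Section Riemann.
Context {R : realType}.
Variables (A beta rho_m u_m rho_p u_p : R).
Implicit Types (S : delta_shock R) (f psi : R * R -> R).

Lemma state_pairingE S (q : R -> R -> R) (c : R -> R) f :
  continuous (front S) -> continuous (u_delta S) -> (forall rho, continuous (q rho)) ->
  cont_compact f -> vanishes_before f ->
  pairing S (fun z => q (regular_density rho_m rho_p S z)
                        (velocity beta u_m u_p S z)) c f =
  region_integral `]-oo, 0[ (front S) (tmul (fun t => q rho_m (u_m + beta * t)) f) +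
  region_integral `]0, +oo[ (front S) (tmul (fun t => q rho_p (u_p + beta * t)) f) +
  curve_integral (front S) (tmul c f).
Proof.
move=> cX cu cq f0 fb.
have cstate rho u : continuous (fun t => q rho (u + beta * t)).
  move=> t; apply: (@continuous_comp _ _ _ (fun t => u + beta * t) (q rho)); last exact: cq.
  exact: (cvgD (cvg_cst u) (cvgM (cvg_cst beta) cvg_id)).
apply: (pairingE (g0 := fun t => q rho_p (u_delta S t))) => //.
- by move=> t; apply: (@continuous_comp _ _ _ (u_delta S) (q rho_p)); [exact: cu|exact: cq].
- by move=> x t xX; rewrite /regular_density /velocity /= xX.
- by move=> t; rewrite /regular_density /velocity /= ltxx eqxx.
- by move=> x t xX; rewrite /regular_density /velocity /= ltNge (ltW xX)/= gt_eqF.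
Qed.

Variables (v w0 : R).

Definition parabolic_shock := {| front := fun t : R => v * t + 2^-1 * beta * t ^+ 2;
              weight := fun t => w0 * t;
              u_delta := fun t => v + beta * t |}.

Lemma C1_fun_front : C1_fun (front parabolic_shock) (u_delta parabolic_shock).
Proof.
split=> [t|t] /=; last exact: (cvgD (cvg_cst v) (cvgM (cvg_cst beta) cvg_id)).
by apply: is_derive_eq; rewrite /GRing.scale /=; field.
Qed.

Lemma C1_fun_cst (p : R) : C1_fun (fun=> p) (cst 0).
Proof. by split=> t; [exact: is_derive_cst|exact: cvg_cst]. Qed.

Lemma C1_fun_linear (q : R) : C1_fun (fun t => q * t) (cst q).
Proof.
split=> [t|t]; last exact: cvg_cst.
by apply: is_derive_eq; rewrite /GRing.scale /=; ring.
Qed.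

Lemma C1_fun_momentum_weight : C1_fun (fun t => w0 * t * (v + beta * t))
                               (fun t => w0 * v + 2 * w0 * beta * t).
Proof.
split=> [t|t]; first by apply: is_derive_eq; rewrite /GRing.scale /=; ring.
exact: (cvgD (cvg_cst (w0 * v)) (cvgM (cvg_cst (2 * w0 * beta)) cvg_id)).
Qed.

Lemma C1_fun_momentum (rho u : R) :
  C1_fun (fun t => rho * (u + beta * t - A / rho)) (cst (beta * rho)).
Proof.
split=> [t|t]; last exact: cvg_cst.
by apply: is_derive_eq; rewrite /GRing.scale /=; ring.
Qed.

Lemma C1_fun_relative_momentum (rho u : R) :
  C1_fun (fun t => rho * (u + beta * t - A / rho) * (u - v)) (cst (beta * rho * (u - v))).
Proof.
split=> [t|t]; last exact: cvg_cst.
by apply: is_derive_eq; rewrite /GRing.scale /=; ring.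
Qed.

Hypotheses (rho_m_neq0 : rho_m != 0) (rho_p_neq0 : rho_p != 0).
Hypothesis mass_RH : w0 = v * (rho_p - rho_m) - (rho_p * u_p - rho_m * u_m).
Hypothesis momentum_RH : w0 * v = v * (rho_p * u_p - rho_m * u_m) -
  (rho_p * u_p ^+ 2 - rho_m * u_m ^+ 2) + A * (u_p - u_m).

(** Relative to the front the two states have the constant velocities [u_m - v]
    and [u_p - v], so the relative fluxes of a density [a] are [a (u_s - v)]. *)
Lemma weak_solution_parabolic_shock :
  weak_solution A beta rho_m u_m rho_p u_p parabolic_shock.
Proof.
move=> psi /test_functionP[C1psi [psi0 psix0 psit0] [psib psixb psitb]].
have C1X := C1_fun_front; have cX := C1_fun_continuous C1X; have [_ cu] := C1X.
have crho (rho : R) : continuous (fun u : R => rho) by exact: cst_continuous.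
have crhou (rho : R) : continuous (fun u : R => rho * u).
  by move=> u; exact: (cvgM (cvg_cst rho) cvg_id).
have cmom (rho : R) : continuous (fun u : R => rho * (u - A / rho)).
  by move=> u; exact: (cvgM (cvg_cst rho) (cvgB cvg_id (cvg_cst (A / rho)))).
have cflux (rho : R) : continuous (fun u : R => rho * u * (u - A / rho)).
  by move=> u; exact: (cvgM (crhou rho u) (cvgB cvg_id (cvg_cst (A / rho)))).
have csrc (rho : R) : continuous (fun u : R => beta * rho) by exact: cst_continuous.
have mL : measurable (`]-oo, 0[%classic : set R) by [].
have mR : measurable (`]0, +oo[%classic : set R) by [].
split.
- rewrite /pair_rho /pair_rho_u.
  rewrite (state_pairingE _ (q := fun rho _ => rho) cX cu crho psit0 psitb).
  rewrite (state_pairingE _ (q := fun rho u => rho * u) cX cu crhou psix0 psixb).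
  rewrite (weak_balance C1X C1psi psi0 psix0 psit0 (r := cst 0)
    (C1_fun_cst rho_m) (C1_fun_cst (rho_m * (u_m - v)))
    (C1_fun_cst rho_p) (C1_fun_cst (rho_p * (u_p - v))) (C1_fun_linear w0)).
  + rewrite (region_integralZ 0 mL cX psi0) (region_integralZ 0 mR cX psi0).
    by rewrite (curve_integralZ 0 cX psi0) !mul0r !addr0 oppr0.
  + by move=> t /=; ring.
  + by move=> t /=; ring.
  + by move=> t /=; ring.
  + by move=> t /=; rewrite mass_RH; ring.
- rewrite /pair_momentum /pair_momentum_flux /pair_source.
  rewrite (state_pairingE _ (q := fun rho u => rho * (u - A / rho)) cX cu cmom psit0 psitb).
  rewrite (state_pairingE _ (q := fun rho u => rho * u * (u - A / rho)) cX cu cflux psix0 psixb).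
  rewrite (state_pairingE _ (q := fun rho _ => beta * rho) cX cu csrc psi0 psib).
  rewrite (weak_balance C1X C1psi psi0 psix0 psit0 (r := fun t => - (beta * (w0 * t)))
    (C1_fun_momentum rho_m u_m) (C1_fun_relative_momentum rho_m u_m)
    (C1_fun_momentum rho_p u_p) (C1_fun_relative_momentum rho_p u_p)
    C1_fun_momentum_weight).
  + rewrite [RHS]opprD; congr (_ + _).
    have cw : continuous (fun t : R => beta * (w0 * t)).
      by move=> t; exact: (cvgM (cvg_cst beta) (cvgM (cvg_cst w0) cvg_id)).
    rewrite -mulN1r -curve_integralZ//; last exact: cc_tmul.
    by congr curve_integral; apply/funext => z; rewrite /tmul /= mulN1r mulNr.
  + by move=> t /=; ring.
  + by move=> t /=; ring.
  + by move=> t /=; ring.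
  + move=> t /=; rewrite momentum_RH.
    have -> : 2 * w0 * beta * t = beta * (w0 * t) + beta * t * w0 by ring.
    rewrite {2}mass_RH; field; exact/andP.
Qed.

End Riemann.

(** * The strength and the speed of the delta shock *)

Section Algebra.
Context {R : rcfType}.
Variables (A rho_m u_m rho_p u_p : R).

Definition strength_sq := rho_p * rho_m * (u_p - u_m) *
  ((u_p - u_m) - (A / rho_p - A / rho_m)).

Hypotheses (A_gt0 : 0 < A) (rho_m_gt0 : 0 < rho_m) (rho_p_gt0 : 0 < rho_p).
Hypotheses (u_p_lt : u_p < u_m - A / rho_m) (rho_neq : rho_p != rho_m).

Let rho_m_neq0 : rho_m != 0. Proof. exact: lt0r_neq0. Qed.
Let rho_p_neq0 : rho_p != 0. Proof. exact: lt0r_neq0. Qed.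
Let jump_neq0 : rho_p - rho_m != 0. Proof. by rewrite subr_eq0. Qed.

Let w0 : R := Num.sqrt strength_sq.
Let v0 := (rho_p * u_p - rho_m * u_m + w0) / (rho_p - rho_m).
Let D := u_m - u_p.

Lemma strength_sqE :
  strength_sq = D * (rho_p * (rho_m * D - A) + A * rho_m).
Proof. by rewrite /strength_sq /D; field; exact/andP. Qed.

Let rhoD : A < rho_m * D.
Proof.
have : A / rho_m < D by move: u_p_lt; rewrite /D; lra.
by rewrite ltr_pdivrMr// mulrC.
Qed.

Let D_gt0 : 0 < D.
Proof. by rewrite -(pmulr_rgt0 _ rho_m_gt0) (lt_trans A_gt0). Qed.

Lemma strength_sq_gt : A ^+ 2 < strength_sq.
Proof.
rewrite strength_sqE mulrDr; apply: (@lt_trans _ _ (D * (A * rho_m))).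
  by rewrite expr2 mulrCA ltr_pM2l// mulrC.
by rewrite ltrDr !mulr_gt0// subr_gt0.
Qed.

Let w0_sq : w0 ^+ 2 = strength_sq.
Proof. by rewrite sqr_sqrtr// (le_trans _ (ltW strength_sq_gt))// sqr_ge0. Qed.

Lemma strength_gt : A < w0.
Proof.
by rewrite -(@ltr_pXn2r _ 2)// ?nnegrE ?sqrtr_ge0 ?(ltW A_gt0)// w0_sq strength_sq_gt.
Qed.

Lemma mass_jump : w0 = v0 * (rho_p - rho_m) - (rho_p * u_p - rho_m * u_m).
Proof. by rewrite /v0; field. Qed.

(** Given the mass jump condition, the momentum jump condition is equivalent to
    [w ^+ 2 = strength_sq], as [rho_p != rho_m]. *)
Lemma strength_sq_jump v w : w = v * (rho_p - rho_m) - (rho_p * u_p - rho_m * u_m) ->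
  w ^+ 2 - strength_sq = (rho_p - rho_m) *
    (w * v - (v * (rho_p * u_p - rho_m * u_m) -
      (rho_p * u_p ^+ 2 - rho_m * u_m ^+ 2) + A * (u_p - u_m))).
Proof. by move=> ->; rewrite strength_sqE /D; ring. Qed.

Lemma momentum_jump : w0 * v0 = v0 * (rho_p * u_p - rho_m * u_m) -
  (rho_p * u_p ^+ 2 - rho_m * u_m ^+ 2) + A * (u_p - u_m).
Proof.
have := strength_sq_jump mass_jump; rewrite w0_sq subrr => /esym/eqP.
by rewrite mulf_eq0 (negbTE jump_neq0) subr_eq0 => /eqP.
Qed.

Lemma speed_gt : u_p < v0.
Proof.
have w0D : 0 < w0 + rho_m * D.
  exact: addr_gt0 (lt_trans A_gt0 strength_gt) (lt_trans A_gt0 rhoD).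
rewrite -subr_gt0 -(pmulr_lgt0 _ w0D).
(* (v0 - u_p) [rho] = w0 - rho_m D: multiply by the conjugate *)
have -> : (v0 - u_p) * (w0 + rho_m * D) = D * (rho_m * D - A).
  apply: (mulfI jump_neq0); transitivity (w0 ^+ 2 - (rho_m * D) ^+ 2).
    by rewrite /v0 /D; field.
  by rewrite w0_sq strength_sqE; ring.
by rewrite mulr_gt0// subr_gt0.
Qed.

Lemma speed_lt : v0 < u_m - A / rho_m.
Proof.
have Aw := strength_gt; have w_gt0 : 0 < w0 by apply: lt_trans Aw.
have w0D : 0 < rho_m * (w0 + rho_p * D) by rewrite mulr_gt0 ?addr_gt0 ?mulr_gt0.
rewrite -subr_gt0 -(pmulr_lgt0 _ w0D).
(* (u_m - v0) [rho] = rho_p D - w0: multiply by the conjugate *)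
have -> : (u_m - A / rho_m - v0) * (rho_m * (w0 + rho_p * D)) = w0 * (w0 - A).
  have -> : w0 * (w0 - A) = strength_sq - w0 * A by rewrite -w0_sq; ring.
  apply: (mulfI jump_neq0).
  transitivity (rho_m * ((rho_p * D) ^+ 2 - w0 ^+ 2) -
      (rho_p - rho_m) * A * (w0 + rho_p * D)).
    by rewrite /v0 /D; field; exact/andP.
  by rewrite w0_sq strength_sqE; ring.
by rewrite mulr_gt0// subr_gt0.
Qed.

(** The entropy bounds make [w] positive, which selects one of the two roots of
    [w ^+ 2 = strength_sq]. *)
Lemma jump_unique v w : w = v * (rho_p - rho_m) - (rho_p * u_p - rho_m * u_m) ->
  w * v = v * (rho_p * u_p - rho_m * u_m) -
    (rho_p * u_p ^+ 2 - rho_m * u_m ^+ 2) + A * (u_p - u_m) ->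
  u_p < v -> v < u_m - A / rho_m -> w = w0 /\ v = v0.
Proof.
move=> mass mom uv vu.
have w_gt0 : 0 < w.
  have -> : w = rho_p * (v - u_p) + rho_m * (u_m - v) by rewrite mass; ring.
  have := divr_gt0 A_gt0 rho_m_gt0 => Arho.
  by rewrite addr_gt0// mulr_gt0// subr_gt0//; lra.
have w2 : w ^+ 2 = strength_sq.
  by apply/eqP; rewrite -subr_eq0 (strength_sq_jump mass) mom subrr mulr0.
have ww : w = w0 by rewrite /w0 -w2 sqrtr_sqr gtr0_norm.
by split=> //; rewrite /v0 -ww mass; field.
Qed.

End Algebra.

(** * Rankine-Hugoniot conditions and uniqueness *)

Section JumpConditions.
Context {R : realType}.
Implicit Types (f g df : R -> R).

Lemma eq_of_derive f g df :
  {within `[0, +oo[, continuous f} -> {within `[0, +oo[, continuous g} ->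
  (forall t : R, 0 < t -> is_derive t 1 f (df t)) ->
  (forall t : R, 0 < t -> is_derive t 1 g (df t)) ->
  f 0 = g 0 -> forall t, 0 <= t -> f t = g t.
Proof.
move=> cf cg fd gd fg0 t t0.
have sub : `[0, t]%classic `<=` `[0, +oo[%classic.
  by apply: subset_itvl; rewrite bnd_simp.
have dh (x : R) : x \in `]0, t[ -> is_derive x 1 (f - g) 0.
  rewrite in_itv/= => /andP[x0 _]; rewrite -(subrr (df x)).
  by apply: is_deriveB; [exact: fd|exact: gd].
have ch : {within `[0, t], continuous (f - g)}.
  move=> x; apply: cvgB; [exact: (continuous_subspaceW sub cf)|].
  exact: (continuous_subspaceW sub cg).
have [c _] := MVT_segment t0 dh ch.
by rewrite mul0r !fctE fg0 subrr subr0 => /eqP; rewrite subr_eq0 => /eqP.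
Qed.

Variables (A beta rho_m u_m rho_p u_p : R).
Hypotheses (rho_m_neq0 : rho_m != 0) (rho_p_neq0 : rho_p != 0).

Lemma parabolic_shock_RH v w0 :
  w0 = v * (rho_p - rho_m) - (rho_p * u_p - rho_m * u_m) ->
  w0 * v = v * (rho_p * u_p - rho_m * u_m) -
    (rho_p * u_p ^+ 2 - rho_m * u_m ^+ 2) + A * (u_p - u_m) ->
  generalized_Rankine_Hugoniot A beta rho_m u_m rho_p u_p (parabolic_shock beta v w0).
Proof.
move=> mass mom t t0; have [dX _] := C1_fun_front beta v w0.
have sp : speed (parabolic_shock beta v w0) t = v + beta * t.
  by rewrite /speed derive1E; exact: derive_val.
split.
- by rewrite sp; exact: dX.
- exact: sp.
- rewrite sp /jump; have -> : (v + beta * t) * (rho_p - rho_m) -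
    (rho_p * (u_p + beta * t) - rho_m * (u_m + beta * t)) = w0 by rewrite mass; ring.
  exact: (C1_fun_linear w0).1.
- rewrite sp /jump; have [dm _] := C1_fun_momentum_weight beta v w0.
  apply: (is_derive_eq (dm t)); rewrite /=.
  rewrite mom -[2 * w0 * beta * t]mulrA.
  have -> : 2 * w0 * (beta * t) = beta * (w0 * t) + beta * t * w0 by ring.
  by rewrite {2}mass; field; exact/andP.
Qed.

(** The form [v + beta t] of [u_delta] determines the derivatives of the front
    and of the weight, hence these functions; the momentum condition at time 1 is
    then the equation for the constants. *)
Lemma RH_constants S : admissible_form beta S ->
  generalized_Rankine_Hugoniot A beta rho_m u_m rho_p u_p S ->
  exists v w, [/\ w = v * (rho_p - rho_m) - (rho_p * u_p - rho_m * u_m),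
    w * v = v * (rho_p * u_p - rho_m * u_m) -
      (rho_p * u_p ^+ 2 - rho_m * u_m ^+ 2) + A * (u_p - u_m) &
    forall t, 0 <= t -> [/\ front S t = front (parabolic_shock beta v w) t,
      weight S t = weight (parabolic_shock beta v w) t &
      u_delta S t = u_delta (parabolic_shock beta v w) t]].
Proof.
move=> [[cX X0] [cw W0] [v uv]] RH.
have uE t : 0 <= t -> u_delta S t = v + beta * t by move=> /uv <-; rewrite subrK.
pose w := v * (rho_p - rho_m) - (rho_p * u_p - rho_m * u_m).
have [dX _] := C1_fun_front beta v w; have [dl cl] := C1_fun_linear w.
have cX0 : continuous (front (parabolic_shock beta v w)).
  exact: C1_fun_continuous (C1_fun_front beta v w).
have cl0 := C1_fun_continuous (C1_fun_linear w).
have frontE t : 0 <= t -> front S t = front (parabolic_shock beta v w) t.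
  move: t; apply: (eq_of_derive (df := fun t => v + beta * t) cX).
  - exact: continuous_subspaceT.
  - by move=> t t0; have [+ sp _ _] := RH t t0; rewrite sp uE// ltW.
  - by rewrite X0 /= expr0n/= !mulr0 addr0.
have weightE t : 0 <= t -> weight S t = w * t.
  move: t; apply: (eq_of_derive (df := cst w) cw).
  - exact: continuous_subspaceT.
  - move=> t t0; have [_ sp + _] := RH t t0; rewrite sp uE ?ltW// /jump.
    by move=> dw; apply: (is_derive_eq dw); rewrite /w /=; ring.
  - by rewrite W0 mulr0.
exists v, w; split=> //; last first.
  by move=> t t0; split; [exact: frontE|exact: weightE|exact: uE].
have [_ sp _] := RH 1 ltr01.
rewrite sp uE// weightE// /jump => d1.
have [dm _] := C1_fun_momentum_weight beta v w.
have d2 : is_derive (1 : R) 1 (fun s => w * s * (v + beta * s))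
   ((v + beta * 1) * (rho_p * (u_p + beta * 1 - A / rho_p) - rho_m * (u_m + beta * 1 - A / rho_m)) -
    (rho_p * (u_p + beta * 1) * (u_p + beta * 1 - A / rho_p) -
     rho_m * (u_m + beta * 1) * (u_m + beta * 1 - A / rho_m)) + beta * (w * 1)).
  (* The formulas for S hold only at nonnegative times, hence near 1. *)
  apply: near_eq_is_derive d1; near=> s.
  have s0 : 0 <= s by apply/ltW; near: s; exact: lt_nbhsr.
  by rewrite weightE// uE.
have /= := etrans (esym (@derive_val _ _ _ _ _ _ _ (dm 1))) (@derive_val _ _ _ _ _ _ _ d2).
rewrite /w => e; apply/eqP; rewrite -subr_eq0; apply/eqP.
move/eqP : e; rewrite -subr_eq0 => /eqP <-; field; exact/andP.
Unshelve. all: by end_near. Qed.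

End JumpConditions.

Theorem theorem3p2 (R : realType) (A beta rho_m u_m rho_p u_p : R)
    (A_gt0 : 0 < A) (rho_m_gt0 : 0 < rho_m) (rho_p_gt0 : 0 < rho_p)
    (u_m_ge0 : 0 <= u_m) (u_p_ge0 : 0 <= u_p)
    (u_p_lt : u_p < u_m - A / rho_m) (rho_neq : rho_p != rho_m) :
  let w0 := Num.sqrt (rho_p * rho_m * (u_p - u_m) *
                      ((u_p - u_m) - (A / rho_p - A / rho_m))) in
  let v_delta := (rho_p * u_p - rho_m * u_m + w0) / (rho_p - rho_m) in
  let S := {| front := fun t => v_delta * t + 2^-1 * beta * t ^+ 2;
              weight := fun t => w0 * t;
              u_delta := fun t => v_delta + beta * t |} in
  [/\ delta_shock_solution A beta rho_m u_m rho_p u_p S,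
      generalized_Rankine_Hugoniot A beta rho_m u_m rho_p u_p S,
      over_compressive A beta rho_m u_m u_p S &
      forall S' : delta_shock R,
        delta_shock_solution A beta rho_m u_m rho_p u_p S' ->
        over_compressive A beta rho_m u_m u_p S' ->
        forall t, 0 <= t ->
          [/\ front S' t = front S t, weight S' t = weight S t &
              u_delta S' t = u_delta S t]].
Proof.
move=> w0 v_delta S.
have rho_m_neq0 := lt0r_neq0 rho_m_gt0; have rho_p_neq0 := lt0r_neq0 rho_p_gt0.
have mass := mass_jump A u_m u_p rho_neq.
have mom := momentum_jump A_gt0 rho_m_gt0 rho_p_gt0 u_p_lt rho_neq.
have RH : generalized_Rankine_Hugoniot A beta rho_m u_m rho_p u_p S.
  exact: parabolic_shock_RH mass mom.
split=> //.
- split=> //.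
  + split.
    * split; last by rewrite /= expr0n/= !mulr0 addr0.
      apply: continuous_subspaceT.
      exact: C1_fun_continuous (C1_fun_front beta v_delta w0).
    * split; last by rewrite /= mulr0.
      apply: continuous_subspaceT; exact: C1_fun_continuous (C1_fun_linear w0).
    * by exists v_delta => t _; rewrite /= addrK.
  + have front0 : front S 0 = 0 by rewrite /= expr0n/= !mulr0 addr0.
    split=> x x0; rewrite /regular_density /velocity front0 /= mulr0 addr0.
      by rewrite x0.
    by rewrite ltNge (ltW x0)/= gt_eqF// addr0.
  + exact: weak_solution_parabolic_shock mass mom.
- move=> t _; rewrite /S /= ltrD2r; split.
    exact: (speed_gt A_gt0 rho_m_gt0 rho_p_gt0 u_p_lt rho_neq).
  by rewrite ltrD2r; exact: (speed_lt A_gt0 rho_m_gt0 rho_p_gt0 u_p_lt rho_neq).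
- move=> S' [adm _ _ RH'] oc.
  have [v [w [mass' mom' eqS]]] := RH_constants rho_m_neq0 rho_p_neq0 adm RH'.
  have [+ +] := oc 1 ltr01; have [_ _ ->] := eqS 1 ler01; rewrite /= !ltrD2r => uv vu.
  have [ww vv] := jump_unique A_gt0 rho_m_gt0 rho_p_gt0 rho_neq mass' mom' uv vu.
  by move: eqS; rewrite ww vv.
Qed.
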